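(* Let $R$ be a commutative ring with identity and $A$ a commutative $R$-algebra with identity $1_A$. Let $L=[,]$ be a Lie bracket operation on $A$. Define $\Gamma(L)=\{a\in A:[ax,y]=a[x,y]\text{ for all }x,y\in A\}$ and, for $t\in A$, define the $R$-module endomorphism $L_t$ of $A$ by $L_t(x)=[1_A,x]+xt$. Then $L$ is induced by an averaging operator on $A$ if and only if $[x,y]=x[1_A,y]+y[x,1_A]$ for all $x,y\in A$ and, for some fixed $t\in A$, $L_t(A)\subseteq\Gamma(L)$.
   Context: An averaging operator on $A$ is an $R$-module endomorphism $f:A\to A$ with $f(xf(y))=f(x)f(y)$ for all $x,y\in A$. A Lie bracket operation on the $R$-module $A$ is an $R$-bilinear operation $[,]:A\times A\to A$ with $[x,x]=0$ and $[[x,y],z]+[[y,z],x]+[[z,x],y]=0$ for all $x,y,z\in A$ (no compatibility with the multiplication of $A$ is assumed). A Lie bracket operation $[,]$ is induced by an $R$-module endomorphism $f$ of $A$ if $[x,y]=[x,y]_f:=xf(y)-yf(x)$ for all $x,y\in A$. *)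

(* Defs.v *)
From HB Require Import structures.
From mathcomp Require Import all_boot all_algebra.

Set Implicit Arguments.
Unset Strict Implicit.
Unset Printing Implicit Defensive.

Import GRing.Theory.
Local Open Scope ring_scope.

(* The library's [comAlgType R] forces [1 != 0] in the algebra. To keep the   *)
(* zero algebra (and the zero base ring), a commutative unital R-algebra is   *)
(* given by its structure morphism [phi : R -> A]: [comAlg phi] is the ring A *)
(* with the R-module structure [r *: x = phi r * x].                          *)
Definition comAlg (R A : comPzRingType) (phi : {rmorphism R -> A}) : Type := A.

Section ComAlg.
Variables (R A : comPzRingType) (phi : {rmorphism R -> A}).

HB.instance Definition _ := GRing.ComPzRing.on (comAlg phi).

Definition comAlg_scale (r : R) (x : comAlg phi) : comAlg phi :=
  (phi r : comAlg phi) * x.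

Fact comAlg_scalerA r s x :
  comAlg_scale r (comAlg_scale s x) = comAlg_scale (r * s) x.
Proof. by rewrite /comAlg_scale mulrA [phi (r * s)]rmorphM. Qed.

Fact comAlg_scale1r : left_id 1 comAlg_scale.
Proof. by move=> x; rewrite /comAlg_scale [phi 1]rmorph1 mul1r. Qed.

Fact comAlg_scalerDr : right_distributive comAlg_scale +%R.
Proof. by move=> r x y; rewrite /comAlg_scale mulrDr. Qed.

Fact comAlg_scalerDl x : {morph comAlg_scale^~ x : r s / r + s}.
Proof. by move=> r s; rewrite /comAlg_scale [phi (r + s)]rmorphD mulrDl. Qed.

HB.instance Definition _ := GRing.Zmodule_isLmodule.Build R (comAlg phi)
  comAlg_scalerA comAlg_scale1r comAlg_scalerDr comAlg_scalerDl.

End ComAlg.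

Section LieBrackets.
Variables (R A : comPzRingType) (phi : {rmorphism R -> A}).
Local Notation B := (comAlg phi).

Definition averaging (f : {linear B -> B}) : Prop :=
  forall x y : B, f (x * f y) = f x * f y.

Record lie_bracket (L : B -> B -> B) : Prop := LieBracket {
  lie_linearl : forall y : B, linear (L^~ y);
  lie_linearr : forall x : B, linear (L x);
  lie_alt : forall x : B, L x x = 0;
  lie_jacobi : forall x y z : B, L (L x y) z + L (L y z) x + L (L z x) y = 0
}.

Definition induced_by (L : B -> B -> B) (f : {linear B -> B}) : Prop :=
  forall x y : B, L x y = x * f y - y * f x.

Definition Gamma (L : B -> B -> B) (a : B) : Prop :=
  forall x y : B, L (a * x) y = a * L x y.

Definition Lt (L : B -> B -> B) (t x : B) : B := L 1 x + x * t.

Lemma Lt_linear L t : lie_bracket L -> linear (Lt L t).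
Proof.
move=> hL r x y; rewrite /Lt (lie_linearr hL) scalerDr mulrDl -addrACA.
by congr (_ + _ + _); rewrite /GRing.scale /= /comAlg_scale mulrA.
Qed.

End LieBrackets.

(* Main.v *)
Require Import Defs.
From HB Require Import structures.
From mathcomp Require Import all_boot all_algebra.

Set Implicit Arguments.
Unset Strict Implicit.
Unset Printing Implicit Defensive.

Import GRing.Theory.
Local Open Scope ring_scope.

(** If [f] induces [L], then [f 1 = t] forces [f = Lt L t], since
    [L 1 x = f x - x f(1)]. Conversely, when [L x y = x L(1,y) + y L(x,1)], every
    [Lt L t] induces [L], and the averaging identity for [Lt L t] says exactly
    that its values lie in [Gamma L]. *)

(** Polarization: expand [L (x + y) (x + y) = 0], additivity being linearity at the scalar [1]. *)
Lemma lie_anticomm (R A : comPzRingType) (phi : {rmorphism R -> A})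
    (L : comAlg phi -> comAlg phi -> comAlg phi) (hL : lie_bracket L) x y :
  L x y = - L y x.
Proof.
have Dl u v z : L (u + v) z = L u z + L v z.
  by have := lie_linearl hL z 1 u v; rewrite !scale1r.
have Dr z u v : L z (u + v) = L z u + L z v.
  by have := lie_linearr hL z 1 u v; rewrite !scale1r.
have := lie_alt hL (x + y).
by rewrite Dl !Dr !(lie_alt hL) add0r addr0 => /eqP; rewrite addr_eq0 => /eqP.
Qed.

Theorem theorem4p6 (R A : comPzRingType) (phi : {rmorphism R -> A})
    (L : comAlg phi -> comAlg phi -> comAlg phi) (hL : lie_bracket L) :
  (exists2 f : {linear comAlg phi -> comAlg phi}, averaging f & induced_by L f)
  <->
  (forall x y : comAlg phi, L x y = x * L 1 y + y * L x 1) /\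
  (exists t : comAlg phi, forall x : comAlg phi, Gamma L (Lt L t x)).
Proof.
split=> [[f avf Lf]|[Lder [t Gt]]].
  split=> [x y|].
    by rewrite !Lf !mul1r !mulrBr (mulrCA y x) addrA subrK.
  exists (f 1) => z x y.
  have -> : Lt L (f 1) z = f z by rewrite /Lt Lf mul1r subrK.
  (* Commuting to [x * f z] lets the averaging identity pull [f z] out of [f]. *)
  rewrite !Lf [f z * x]mulrC avf mulrBr.
  by congr (_ - _); [rewrite mulrAC mulrC | rewrite mulrA mulrC].
pose linL := GRing.isLinear.Build R (comAlg phi) (comAlg phi) *:%R (Lt L t)
  (Lt_linear t hL).
pose f : {linear comAlg phi -> comAlg phi} := HB.pack (Lt L t) linL.
exists f => [x y|x y].
  change (Lt L t (x * Lt L t y) = Lt L t x * Lt L t y).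
  (* [Gamma L] only speaks of the first slot; anticommutativity carries it to the second. *)
  have L1 : L 1 (x * Lt L t y) = Lt L t y * L 1 x.
    by rewrite (lie_anticomm hL) [x * _]mulrC Gt -mulrN -(lie_anticomm hL).
  by rewrite [LHS]/Lt L1 [x * _]mulrC -mulrA -mulrDr mulrC.
change (L x y = x * Lt L t y - y * Lt L t x).
(* The terms [x * (y * t)] and [y * (x * t)] cancel, whatever [t] is. *)
rewrite Lder (lie_anticomm hL x 1) /Lt !mulrDr (mulrCA y x) mulrN.
by rewrite opprD addrACA subrr addr0.
Qed.
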